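(* There are absolute constants $c,C>0$ such that for every prime power $q$ and every integer $n\ge 2$, $$c\exp\left(-C\max\{\sqrt{n\log n\log q},\,\log q\}\right)\le\mathbb{E}L(\pi_n)-\mathbb{E}L_q(f_n)\le C\exp\left(-c\max\{\sqrt{n\log n\log q},\,\log q\}\right).$$
   Context: $\log$ is the natural logarithm. $\pi_n$ is a uniformly random permutation in the symmetric group $S_n$, and $L(\pi)$ is the length of the longest cycle in the cycle decomposition of $\pi$. $f_n=f_{n,q}$ is a uniformly random element of the set of monic polynomials of degree $n$ over the finite field $\mathbb{F}_q$, and $L_q(f)$ is the largest degree of an irreducible polynomial dividing $f\in\mathbb{F}_q[T]$. *)

(* Defs.v *)
From HB Require Import structures.
From mathcomp Require Import all_boot all_order all_fingroup all_algebra.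
From mathcomp Require Import reals sequences exp.

Set Implicit Arguments.
Unset Strict Implicit.
Unset Printing Implicit Defensive.

Import Order.TTheory GRing.Theory Num.Theory.
Local Open Scope ring_scope.

Definition prime_power (q : nat) : Prop :=
  exists p k : nat, [/\ prime p, (0 < k)%N & q = (p ^ k)%N].

(* Expectation of X at a uniformly random element of A. *)
Definition uniform_mean (R : realType) (T : finType) (A : {set T})
    (X : T -> R) : R :=
  (\sum_(x in A) X x) / #|A|%:R.

(* [porbits s] contains the fixed points of s as singletons. *)
Definition longest_cycle (n : nat) (s : 'S_n) : nat :=
  \max_(O in porbits s) #|O|.

(* For f != 0, every divisor g of f has size g <= size f, so restricting g to
   the finite type {poly_(size f) F} loses nothing; deg g = (size g).-1. *)
Definition max_irr_degree (F : finFieldType) (f : {poly F}) : nat :=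
  \max_(g : {poly_(size f) F} | irreducibleb g && (g %| f)) (size g).-1.

(* {poly_m F} is the type of polynomials of size <= m, i.e. of degree < m. *)
Definition monic_polys (F : finFieldType) (n : nat) : {set {poly_n.+1 F}} :=
  [set f : {poly_n.+1 F} | ((f : {poly F}) \is monic) && (size f == n.+1)].

Definition E_longest_cycle (R : realType) (n : nat) : R :=
  uniform_mean [set: 'S_n] (fun s => (longest_cycle s)%:R).

Definition E_max_irr_degree (R : realType) (F : finFieldType) (n : nat) : R :=
  uniform_mean (monic_polys F n) (fun f => (max_irr_degree f)%:R).

Definition error_exponent (R : realType) (n q : nat) : R :=
  Num.max (Num.sqrt (n%:R * ln n%:R * ln q%:R)) (ln q%:R).

(* Main.v *)
Require Import Defs.
From HB Require Import structures.
From mathcomp Require Import all_boot all_order all_fingroup all_algebra.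
From mathcomp Require Import reals sequences exp.
From mathcomp Require Import ring lra zify.

Set Implicit Arguments.
Unset Strict Implicit.
Unset Printing Implicit Defensive.

Import Order.TTheory GRing.Theory Num.Theory.
Local Open Scope ring_scope.

(** Summing tails, E L(pi_n) - E L_q(f_n) is the sum over 1 <= m < n of
    g_n - p_n, where p_n is the probability that all cycles of pi_n have length
    at most m and g_n the probability that all irreducible factors of f_n have
    degree at most m [longest_cycle_gap].

    For fixed m both sequences have an exponential generating form
    exp (sum_d a_d u^d / d).  For permutations a_d = 1 if d <= m and a_d = 0
    otherwise [perm_smooth_rec].  For polynomials a_d is q^-d times the sum of
    deg P over the monic irreducible P with deg P <= m and deg P dividing d
    [poly_smooth_rec]; without the restriction deg P <= m this sum is q^d (Gauss),
    so again a_d = 1 for d <= m, but now a_d is a small nonnegative number for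
    d > m: at least q^-d, because of the polynomial X, and at most 2 q^(-d/2),
    because a proper divisor of d is at most d/2.  Hence g_n >= p_n, and only the
    weights beyond m contribute to the difference.  Power series are avoided by
    working with the equivalent recurrence n g_n = sum_d a_d g_(n-d), obtained by
    logarithmic differentiation.

    Lower bound.  The weight a_(m+1) alone gives
    g_n - p_n >= a_(m+1) / (m+1) * p_(n-m-1), and p_k >= n^-(k/m); so one term is
    at least exp (- (3 m log q + (n/m) log n)) [smooth_gap_lower].  Balancing with
    m close to sqrt (n log n / log q) / 2, or m = 1 when this is less than 1, makes
    the exponent at most 7 times the stated one [exists_good_scale].

    Upper bound, with E the stated exponent.  If m log q >= E, the total extra
    weight is O(q^(-m/4)), and it bounds g_n - p_n [gap_le_large].  Otherwise the
    trivial bound g_n - p_n <= g_n suffices: Rankin's method with the parameter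
    exp t, t = min (log q / 8, log n / (8 m)), gives
    g_n <= exp (- t n + O(n^(1/4))) and t n >= E / 8 [gap_le_small].  The n terms
    of the sum cost a factor n = O(exp (E / 32)). *)

(** * The recurrence of exp (sum_d a_d u^d / d) *)

(** This says g_0 + g_1 u + ... = exp (sum_d a_d u^d / d) up to degree N, in the
    form u G' = (sum_d a_d u^d) G. *)
Definition log_deriv_rec (R : realType) (N : nat) (a g : nat -> R) : Prop :=
  g 0%N = 1 /\ forall n, (0 < n <= N)%N ->
    n%:R * g n = \sum_(d < n) a d.+1 * g (n - d.+1)%N.

Definition upto (R : realType) (m d : nat) : R := (d <= m)%:R.

Lemma log_deriv_rec_ge0 (R : realType) N (a g : nat -> R) n :
  (forall d, 0 <= a d) -> log_deriv_rec N a g -> (n <= N)%N -> 0 <= g n.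
Proof.
move=> a0 [g0 gS]; elim/ltn_ind: n => -[_ _|n IH nN]; first by rewrite g0.
rewrite -(pmulr_rge0 _ (ltr0Sn R n)) gS //; apply: sumr_ge0 => d _.
by rewrite mulr_ge0 // IH //; lia.
Qed.

Lemma log_deriv_rec_le1 (R : realType) N (a g : nat -> R) n :
  (forall d, 0 <= a d <= 1) -> log_deriv_rec N a g -> (n <= N)%N -> g n <= 1.
Proof.
move=> a01 gr; have [g0 gS] := gr.
elim/ltn_ind: n => -[_ _|n IH nN]; first by rewrite g0.
rewrite -(ler_pM2l (ltr0Sn R n)) gS // mulr1.
rewrite -[leRHS]mulr1 mulr_natl -[X in 1 *+ X]card_ord -sumr_const.
apply: ler_sum => d _; have /andP[ad0 ad1] := a01 d.+1.
rewrite mulr_ile1 //; last by apply: IH; lia.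
by apply: (log_deriv_rec_ge0 _ gr); [move=> e; case/andP: (a01 e)|lia].
Qed.

Lemma log_deriv_rec_le (R : realType) N (a b g p : nat -> R) n :
  (forall d, 0 <= b d <= a d) -> log_deriv_rec N a g -> log_deriv_rec N b p ->
  (n <= N)%N -> p n <= g n.
Proof.
move=> ba gr pr; have [g0 gS] := gr; have [p0 pS] := pr.
elim/ltn_ind: n => -[_ _|n IH nN]; first by rewrite g0 p0.
rewrite -(ler_pM2l (ltr0Sn R n)) gS // pS //.
apply: ler_sum => d _; have /andP[b0 bad] := ba d.+1.
rewrite ler_pM //; last by apply: IH; lia.
by apply: (log_deriv_rec_ge0 _ pr); [move=> e; case/andP: (ba e)|lia].
Qed.

(** In terms of generating functions, G / P = exp (sum_d (a_d - b_d) u^d / d) has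
    nonnegative coefficients and the coefficient of u^(k+1) in it is at least
    (a_(k+1) - b_(k+1)) / (k+1).  The proof by induction splits the recurrence of
    g - p into the weights b acting on g - p and the extra weights a - b acting
    on g. *)
Lemma log_deriv_rec_gap (R : realType) N (a b g p : nat -> R) k n :
  (forall d, 0 <= b d <= a d) -> log_deriv_rec N a g -> log_deriv_rec N b p ->
  (n + k.+1 <= N)%N ->
  (a k.+1 - b k.+1) / k.+1%:R * p n <= g (n + k.+1)%N - p (n + k.+1)%N.
Proof.
move=> ba gr pr; have [g0 gS] := gr; have [p0 pS] := pr.
have b0 d : 0 <= b d by case/andP: (ba d).
have a0 d : 0 <= a d by case/andP: (ba d) => /le_trans h /h.
have leba d : b d <= a d by case/andP: (ba d).
have gap0 j : (j <= N)%N -> 0 <= g j - p j.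
  by move=> jN; rewrite subr_ge0 (log_deriv_rec_le ba gr pr).
set e := _ / _; have e0 : 0 <= e by rewrite divr_ge0 // subr_ge0.
elim/ltn_ind: n => n IH nN.
have nk0 : 0 < (n + k.+1)%:R :> R by rewrite ltr0n addnS.
rewrite -(ler_pM2l nk0) mulrBr gS ?pS ?addnS //=; try by rewrite -addnS.
have -> : \sum_(d < (n + k).+1) a d.+1 * g ((n + k).+1 - d.+1)%N
        - \sum_(d < (n + k).+1) b d.+1 * p ((n + k).+1 - d.+1)%N
  = \sum_(d < (n + k).+1) b d.+1 * (g ((n + k).+1 - d.+1)%N - p ((n + k).+1 - d.+1)%N)
    + \sum_(d < (n + k).+1) (a d.+1 - b d.+1) * g ((n + k).+1 - d.+1)%N.
  by rewrite -sumrB -big_split; apply: eq_bigr => d _ /=; ring.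
have extra : (a k.+1 - b k.+1) * p n
   <= \sum_(d < (n + k).+1) (a d.+1 - b d.+1) * g ((n + k).+1 - d.+1)%N.
  have kn : (k < (n + k).+1)%N by lia.
  rewrite (bigD1 (Ordinal kn)) //= subSS addnK ler_wpDr //.
    apply: sumr_ge0 => d _; rewrite mulr_ge0 ?subr_ge0 //.
    by apply: (log_deriv_rec_ge0 _ gr) => //; lia.
  by rewrite ler_wpM2l ?subr_ge0 // (log_deriv_rec_le ba gr pr) //; lia.
have old : e * (n%:R * p n)
   <= \sum_(d < (n + k).+1) b d.+1 * (g ((n + k).+1 - d.+1)%N - p ((n + k).+1 - d.+1)%N).
  have -> : n%:R * p n = \sum_(d < n) b d.+1 * p (n - d.+1)%N.
    case: (posnP n) => [->|n0]; first by rewrite mul0r big_ord0.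
    by rewrite pS // n0 //; lia.
  rewrite mulr_sumr.
  rewrite (big_ord_widen (n + k).+1 (fun d => e * (b d.+1 * p (n - d.+1)%N))) /=;
    last by lia.
  rewrite big_mkcond /=; apply: ler_sum => d _; case: ifP => dn.
    rewrite mulrCA ler_wpM2l //.
    have -> : ((n + k).+1 - d.+1 = (n - d.+1) + k.+1)%N by lia.
    by apply: IH; lia.
  by rewrite mulr_ge0 // gap0 //; lia.
apply: le_trans (lerD old extra).
have -> : a k.+1 - b k.+1 = e * k.+1%:R by rewrite /e divfK // pnatr_eq0.
by rewrite -addnS natrD le_eqVlt; apply/orP; left; apply/eqP; ring.
Qed.

Lemma upto_itv (R : realType) m d : 0 <= upto R m d <= 1.
Proof. by rewrite /upto; case: (_ <= _)%N; rewrite ?lexx ler01. Qed.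

(** Keeping only the term d = m of the recurrence, n p_n >= p_(n-m), and iterating
    n / m times, down to p_k = 1 for k < m. *)
Lemma upto_solution_ge (R : realType) N m (p : nat -> R) n : (0 < m)%N ->
  log_deriv_rec N (upto R m) p -> (n <= N)%N -> (0 < N)%N ->
  N%:R ^- (n %/ m) <= p n.
Proof.
move=> m0 pr nN N0; have [p0 pS] := pr.
have u0 d : 0 <= upto R m d by case/andP: (upto_itv R m d).
elim/ltn_ind: n nN => n IH nN.
have [nm|mn] := ltnP n m.
  rewrite divn_small // expr0 invr1.
  elim/ltn_ind: n nm nN {IH} => -[_ _|n IH nm nN]; first by rewrite p0.
  rewrite -(ler_pM2l (ltr0Sn R n)) pS // mulr1 -[leLHS]mulr1 mulr_natl.
  rewrite -[X in 1 *+ X]card_ord -sumr_const; apply: ler_sum => d _.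
  by rewrite /upto (leq_trans (ltn_ord d) (ltnW nm)) mul1r; apply: IH; lia.
have n0 : (0 < n)%N by lia.
have -> : (n %/ m = ((n - m) %/ m).+1)%N.
  by rewrite -{1}(subnK mn) divnDr ?dvdnn // divnn m0 addn1.
have IHm : N%:R ^- ((n - m) %/ m) <= p (n - m)%N by apply: IH; lia.
have N0R : 0 < N%:R :> R by rewrite ltr0n.
rewrite exprS invfM -(ler_pM2l (_ : 0 < n%:R)) ?ltr0n //.
rewrite pS ?n0 //.
have mn' : (m.-1 < n)%N by lia.
rewrite (bigD1 (Ordinal mn')) //= prednK // {1}/upto leqnn mul1r.
rewrite ler_wpDr //.
  apply: sumr_ge0 => d _; rewrite mulr_ge0 //.
  by apply: (log_deriv_rec_ge0 u0 pr); lia.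
apply: le_trans IHm; rewrite mulrA ler_piMl ?invr_ge0 ?exprn_ge0 ?ler0n //.
by rewrite ler_pdivrMr // mul1r ler_nat.
Qed.

(** If S is the total weight beyond m, the recurrence makes n (g_n - p_n) at most
    the sum of m earlier differences plus S, and m + 1 <= n when the tail is
    present; so the bound S propagates. *)
Lemma gap_le_tail (R : realType) N m (a g p : nat -> R) n :
  (forall d, 0 <= a d <= 1) -> (forall d, (0 < d <= m)%N -> a d = 1) ->
  log_deriv_rec N a g -> log_deriv_rec N (upto R m) p -> (n <= N)%N ->
  g n - p n <= \sum_(d < N | (m <= d)%N) a d.+1.
Proof.
move=> a01 a1 gr pr; have [g0 gS] := gr; have [p0 pS] := pr.
have a0 d : 0 <= a d by case/andP: (a01 d).
set S := \sum_(_ < _ | _) _; have S0 : 0 <= S by apply: sumr_ge0.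
elim/ltn_ind: n => -[_ _|n IH nN]; first by rewrite g0 p0 subrr.
have sumE : n.+1%:R * (g n.+1 - p n.+1) =
    \sum_(d < n.+1 | (d < m)%N) (g (n.+1 - d.+1)%N - p (n.+1 - d.+1)%N)
    + \sum_(d < n.+1 | (m <= d)%N) a d.+1 * g (n.+1 - d.+1)%N.
  rewrite mulrBr gS // pS // -sumrB (bigID (fun d : 'I__ => (d < m)%N)) /=.
  congr (_ + _); last first.
    apply: eq_big => d; first by rewrite -leqNgt.
    by rewrite /upto -leqNgt => /leq_gtF ->; rewrite mul0r subr0.
  by apply: eq_bigr => d dm; rewrite a1 ?dm // /upto dm !mul1r.
have tail : \sum_(d < n.+1 | (m <= d)%N) a d.+1 * g (n.+1 - d.+1)%N
    <= (if (m <= n)%N then S else 0).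
  case: ifP => mn; last by rewrite big1 // => d; have := ltn_ord d; lia.
  apply: (@le_trans _ _ (\sum_(d < n.+1 | (m <= d)%N) a d.+1)).
    apply: ler_sum => d _; rewrite ler_piMr //.
    by apply: (log_deriv_rec_le1 a01 gr); lia.
  rewrite (big_ord_widen_cond N (fun d => m <= d)%N (fun d => a d.+1)) //.
  rewrite /S [leLHS]big_mkcond [leRHS]big_mkcond /=; apply: ler_sum => d _.
  by case: (m <= d)%N; case: (d < _)%N => //=.
have head : \sum_(d < n.+1 | (d < m)%N) (g (n.+1 - d.+1)%N - p (n.+1 - d.+1)%N)
    <= (minn m n.+1)%:R * S.
  have -> : (minn m n.+1)%:R * S = \sum_(d < n.+1 | (d < m)%N) S.
    rewrite sumr_const mulr_natl; congr (_ *+ _).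
    rewrite -[LHS]card_ord -sum1_card -sum1_card.
    rewrite (big_ord_widen_cond n.+1 xpredT (fun=> 1%N)) ?geq_minr //=.
    by apply: eq_bigl => d; rewrite leq_min ltn_ord andbT.
  by apply: ler_sum => d _; apply: IH; lia.
rewrite -(ler_pM2l (ltr0Sn R n)) sumE.
apply: le_trans (lerD head tail) _.
case: ifP => mn.
  by rewrite -[X in _ + X]mul1r -mulrDl ler_wpM2r // natr1 ler_nat; lia.
by rewrite addr0 ler_wpM2r // ler_nat geq_minr.
Qed.

(** Rankin's method without a generating function: for n <= K the bound is at
    least 1; for n > K the recurrence reproduces it with a factor K / n <= 1. *)
Lemma rankin_bound (R : realType) N (a g : nat -> R) (t K : R) n :
  (forall d, 0 <= a d <= 1) -> log_deriv_rec N a g -> 0 <= t ->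
  \sum_(d < N) a d.+1 * expR (t * d.+1%:R) <= K -> (n <= N)%N ->
  g n <= expR (t * (K - n%:R)).
Proof.
move=> a01 gr t0 aK; have [g0 gS] := gr.
have a0 d : 0 <= a d by case/andP: (a01 d).
elim/ltn_ind: n => n IH nN.
have [nK|Kn] := leP n%:R K.
  apply: le_trans (log_deriv_rec_le1 a01 gr nN) _.
  rewrite -[leLHS]expR0 ler_expR.
  by apply: mulr_ge0; rewrite // subr_ge0.
case: n IH nN Kn => [|n] IH nN Kn.
  have : 0 <= K by apply: le_trans aK; apply: sumr_ge0 => d _; rewrite mulr_ge0 ?expR_ge0.
  by move=> /le_lt_trans /(_ Kn); rewrite ltxx.
rewrite -(ler_pM2l (ltr0Sn R n)) gS //.
apply: (@le_trans _ _ (K * expR (t * (K - n.+1%:R)))); last first.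
  by rewrite ler_wpM2r ?expR_ge0 // ltW.
apply: le_trans (ler_wpM2r (expR_ge0 _) aK).
rewrite (big_ord_widen N (fun d => a d.+1 * g (n.+1 - d.+1)%N)) //.
rewrite big_mkcond /= mulr_suml; apply: ler_sum => d _.
case: ifP => dn; last by rewrite !mulr_ge0 ?expR_ge0.
rewrite -mulrA -expRD ler_wpM2l //.
apply: le_trans (IH _ _ _) _; [lia|lia|].
by rewrite ler_expR natrB // le_eqVlt; apply/orP; left; apply/eqP; ring.
Qed.

(** * Permutations with bounded cycle lengths *)

Definition cycles_le (T : finType) (m : nat) (s : {perm T}) : bool :=
  [forall x, #|porbit s x| <= m]%N.

(** Leaving the cycle of a unconstrained lets one shorten that cycle point by point
    while the other cycles stay put. *)
Definition other_cycles_le (T : finType) (m : nat) (a : T) (s : {perm T}) : bool :=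
  [forall x, (x \notin porbit s a) ==> (#|porbit s x| <= m)]%N.

Definition smooth_perms (T : finType) (m : nat) (A : {set T}) : {set {perm T}} :=
  [set s | perm_on A s && cycles_le m s].

Definition marked_perms (T : finType) (m : nat) (A : {set T}) (a : T) (j : nat) :
    {set {perm T}} :=
  [set s | [&& perm_on A s, #|porbit s a| == j & other_cycles_le m a s]].

Lemma porbit_sub (T : finType) (s : {perm T}) (B : {set T}) x :
  x \in B -> (forall y, y \in B -> s y \in B) -> porbit s x \subset B.
Proof.
move=> xB sB; apply/subsetP => _ /porbitP[i ->].
by elim: i => [|i IH]; rewrite ?perm1 // expgSr permM sB.
Qed.

Lemma porbit_stable (T : finType) (s : {perm T}) x y :
  (s y \in porbit s x) = (y \in porbit s x).
Proof. by rewrite -!eq_porbit_mem -{2}(expg1 s) porbit_perm. Qed.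

Lemma porbit_fixed (T : finType) (s : {perm T}) x :
  s x = x -> porbit s x = [set x].
Proof.
move=> sx; apply/eqP; rewrite eqEsubset sub1set porbit_id andbT.
by apply: porbit_sub => [|y]; rewrite ?set11 // => /set1P->; rewrite sx set11.
Qed.

(** Composing with the transposition of a and b = s a bypasses b: it becomes a
    fixed point, the cycle of a loses exactly b, and no other cycle changes. *)
Lemma porbit_splice (T : finType) (s : {perm T}) a b : s a = b -> a != b ->
  let s' := (tperm a b * s)%g in
  [/\ porbit s a = b |: porbit s' a, b \notin porbit s' a
    & forall x, x \notin porbit s a -> porbit s' x = porbit s x].
Proof.
move=> sab nab s'.
have s'b : s' b = b by rewrite permM tpermR.
have s'a : s' a = s b by rewrite permM tpermL.
have s'E y : y != a -> y != b -> s' y = s y.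
  by move=> ya yb; rewrite permM tpermD // eq_sym.
have bOa : b \notin porbit s' a.
  by rewrite porbit_sym (porbit_fixed s'b) inE.
have bO : b \in porbit s a by rewrite -sab -{1}(expg1 s) mem_porbit.
split=> // [|x xO].
  apply/eqP; rewrite eqEsubset; apply/andP; split.
    apply: porbit_sub => [|y]; first by rewrite !inE porbit_id orbT.
    rewrite !inE; case: (eqVneq y b) => [-> _|yb /= yO].
      by rewrite -s'a porbit_stable porbit_id orbT.
    case: (eqVneq y a) => [->|ya]; first by rewrite sab eqxx.
    by rewrite -s'E // porbit_stable yO orbT.
  rewrite subUset sub1set bO /=; apply: porbit_sub => [|y yO].
    exact: porbit_id.
  by rewrite permM porbit_stable; case: tpermP => // _; rewrite porbit_id.
have st y : y \notin porbit s a -> s' y = s y.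
  move=> yO; apply: s'E; apply: contraNneq yO => ->; [exact: porbit_id|exact: bO].
suff sub (u v : {perm T}) : (forall y, y \notin porbit s a -> u y = v y) ->
    (forall y, (v y \in porbit s a) = (y \in porbit s a)) ->
    porbit u x \subset porbit v x.
  have stO y : (s' y \in porbit s a) = (y \in porbit s a).
    by rewrite permM porbit_stable; case: tpermP => [->|->|]; rewrite ?bO ?porbit_id.
  apply/eqP; rewrite eqEsubset; apply/andP; split; apply: sub => // y.
    exact: porbit_stable.
  by move=> yO; rewrite st.
move=> uv vO.
have /subset_trans-> // : porbit u x \subset porbit v x :\: porbit s a.
  apply: porbit_sub => [|y]; first by rewrite inE xO porbit_id.
  by rewrite !inE => /andP[yO yv]; rewrite uv // vO yO porbit_stable.
exact: subsetDl.
Qed.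

Lemma perm_on_splice (T : finType) (A : {set T}) a b (s : {perm T}) :
  a \in A -> b \in A -> a != b ->
  perm_on (A :\ b) (tperm a b * s)%g = perm_on A s && (s a == b).
Proof.
move=> aA bA nab; apply/idP/andP => [on'|[onA /eqP sab]].
  have /eqP sab : s a == b.
    have := out_perm on' (_ : b \notin A :\ b); rewrite !inE eqxx => /(_ isT).
    by rewrite permM tpermR => ->.
  rewrite sab eqxx; split=> //; apply/subsetP => y; rewrite inE => sy.
  apply: contraNT sy => yA.
  have := out_perm on' (_ : y \notin A :\ b); rewrite inE (negPf yA) andbF.
  rewrite permM tpermD => [-> //||]; by apply: contraNneq yA => <-.
apply/subsetP => y; rewrite !inE => sy; apply/andP; split.
  by apply: contraNneq sy => ->; rewrite permM tpermR sab.
apply: contraNT sy => yA; rewrite permM tpermD ?(out_perm onA) //.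
  by apply: contraNneq yA => <-.
by apply: contraNneq yA => <-.
Qed.

Lemma marked_perms_fixed (T : finType) m (A : {set T}) a : (0 < m)%N ->
  marked_perms m A a 1 = smooth_perms m (A :\ a).
Proof.
move=> m0; apply/setP => s; rewrite !inE.
apply/and3P/andP => [[onA /cards1P[z Oz] /forallP oth]|[onA /forallP sm]].
  have az : a = z by apply/set1P; rewrite -Oz porbit_id.
  rewrite -az in Oz.
  have sa : s a = a by apply/set1P; rewrite -Oz porbit_stable porbit_id.
  split.
    apply/subsetP => y; rewrite !inE => sy.
    rewrite (subsetP onA) // andbT; by apply: contraNneq sy => ->; rewrite sa.
  apply/forallP => x; have := oth x; rewrite Oz inE.
  by case: eqVneq => //= ->; rewrite Oz cards1.
have sa : s a = a by apply: (out_perm onA); rewrite !inE eqxx.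
split; first by apply: (subset_trans onA); apply: subsetDl.
  by rewrite porbit_fixed // cards1.
by apply/forallP => x; rewrite sm implybT.
Qed.

(** Bypassing b is a bijection, since a transposition is an involution. *)
Lemma card_marked_splice (T : finType) m (A : {set T}) a b j : (0 < m)%N ->
  a \in A -> b \in A -> a != b ->
  #|[set s in marked_perms m A a j.+1 | s a == b]| = #|marked_perms m (A :\ b) a j|.
Proof.
move=> m0 aA bA nab.
rewrite -(@on_card_preimset _ _ (mulg (tperm a b)) (marked_perms m (A :\ b) a j)).
  apply: eq_card => s; rewrite !inE perm_on_splice // -!andbA.
  case: (perm_on A s) => //=; rewrite andbA [LHS]andbC.
  case: (s a =P b) => //= sab.
  have [Oa bO Ox] := porbit_splice sab nab.
  have s'b : (tperm a b * s)%g b = b by rewrite permM tpermR.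
  rewrite {1}Oa cardsU1 bO add1n eqSS; congr (_ && _).
  apply/forallP/forallP => oth x; apply/implyP => xO.
    have [->|xb] := eqVneq x b; first by rewrite porbit_fixed ?cards1.
    have xOa : x \notin porbit s a by rewrite Oa !inE negb_or xb.
    by rewrite Ox //; exact: (implyP (oth x)).
  rewrite -Ox //; apply: (implyP (oth x)).
  by apply: contraNN xO; rewrite Oa !inE => ->; rewrite orbT.
apply: onW_bij; exists (mulg (tperm a b)) => s; exact: tpermKg.
Qed.

Lemma card_marked_step (T : finType) m (A : {set T}) a j : (0 < m)%N ->
  a \in A ->
  #|marked_perms m A a j.+2| =
    (\sum_(b in A :\ a) #|marked_perms m (A :\ b) a j.+1|)%N.
Proof.
move=> m0 aA; rewrite -sum1_card.
rewrite (partition_big (fun s : {perm T} => s a) (mem (A :\ a))) /=.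
  apply: eq_bigr => b; rewrite !inE => /andP[ba bA].
  rewrite -(card_marked_splice _ m0 aA bA) 1?eq_sym // -sum1_card.
  by apply: eq_bigl => s; rewrite [RHS]inE.
move=> s; rewrite !inE => /and3P[onA Oj _].
rewrite perm_closed // aA andbT; apply: contraTneq Oj => /porbit_fixed ->.
by rewrite cards1.
Qed.

(** Classically, the cycle of a with j + 1 points can be chosen in
    (|A| - 1)! / (|A| - j - 1)! ways and the rest is a smooth permutation of the
    |A| - j - 1 remaining points.  The induction on j removes the image of a. *)
Lemma card_marked (R : realType) (T : finType) m (p : nat -> R) n : (0 < m)%N ->
  (forall A : {set T}, (#|A| <= n)%N ->
     #|smooth_perms m A|%:R = #|A|`!%:R * p #|A|) ->
  forall j (A : {set T}) a, a \in A -> (j < #|A| <= n.+1)%N ->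
  #|marked_perms m A a j.+1|%:R = (#|A|.-1)`!%:R * p (#|A| - j.+1)%N.
Proof.
move=> m0 smA; elim=> [|j IH] A a aA /andP[jA An].
  have cA : #|A :\ a| = #|A|.-1 by rewrite (cardsD1 a A) aA.
  by rewrite marked_perms_fixed // smA cA ?subn1 //; lia.
rewrite card_marked_step // natr_sum.
have cA b : b \in A -> #|A :\ b| = #|A|.-1 by move=> bA; rewrite (cardsD1 b A) bA.
rewrite (eq_bigr (fun=> ((#|A|.-2)`!)%:R * p (#|A| - j.+2)%N)) => [|b].
  rewrite sumr_const cA // -[LHS]mulr_natl mulrA -natrM.
  by have -> : #|A|.-1 = #|A|.-2.+1 by lia.
rewrite !inE => /andP[ba bA]; rewrite IH ?inE 1?eq_sym ?ba //.
  by rewrite cA //; congr (_ * p _); lia.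
by rewrite cA //; lia.
Qed.

Lemma card_smooth_marked (T : finType) m (A : {set T}) a : a \in A ->
  #|smooth_perms m A| = (\sum_(j < #|A| | (j < m)%N) #|marked_perms m A a j.+1|)%N.
Proof.
move=> aA; rewrite -sum1_card.
have posA : (0 < #|A|)%N by apply/card_gt0P; exists a.
(* the marked cycle has between 1 and #|A| points, so its length minus 1 is an
   index in 'I_#|A|; the minn only makes the index well typed for every s *)
have Opos s : (#|porbit s a|.-1.+1 = #|porbit s a|)%N.
  by rewrite prednK // card_gt0; apply/set0Pn; exists a; rewrite porbit_id.
have Ole (s : {perm T}) : perm_on A s -> (#|porbit s a| <= #|A|)%N.
  move=> onA; apply: subset_leq_card; apply: porbit_sub => // y.
  by rewrite perm_closed.
have lt_s (s : {perm T}) : (minn #|porbit s a|.-1 #|A|.-1 < #|A|)%N by lia.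
rewrite (partition_big (fun s => Ordinal (lt_s s)) (fun j : 'I__ => (j < m)%N)).
  apply: eq_bigr => j jm; rewrite -[RHS]sum1_card; apply: eq_bigl => s.
  rewrite !inE -val_eqE /= -andbA; case onA: (perm_on A s) => //=.
  have := Ole _ onA; have := Opos s => O1 O2.
  apply/andP/andP => [[/forallP sm /eqP Oj]|[/eqP Oj /forallP oth]].
    by split; [lia|apply/forallP => x; rewrite sm implybT].
  split; last by lia.
  apply/forallP => x; case xO: (x \in porbit s a).
    by move: xO; rewrite -eq_porbit_mem => /eqP->; rewrite Oj.
  by apply: (implyP (oth x)); rewrite xO.
move=> s; rewrite !inE => /andP[onA /forallP /(_ a)] /=.
by have := Ole _ onA; have := Opos s; lia.
Qed.

(** All n <= N are handled inside one group 'S_N, through the permutations supported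
    on an initial segment. *)
Definition perm_smooth_prob (R : realType) (N m n : nat) : R :=
  #|smooth_perms m [set i : 'I_N | (i < n)%N]|%:R / n`!%:R.

(** That the count depends on the support only through its size, and that it obeys
    the recurrence, are proved by one induction: the right-hand side of the
    recurrence mentions only the size. *)
Lemma card_smooth_perms (R : realType) N m n : (0 < m)%N ->
  forall A : {set 'I_N}, #|A| = n ->
   #|smooth_perms m A|%:R = n`!%:R * perm_smooth_prob R N m n
   /\ ((0 < n)%N -> n%:R * perm_smooth_prob R N m n =
       \sum_(d < n) upto R m d.+1 * perm_smooth_prob R N m (n - d.+1)%N).
Proof.
move=> m0.
have key : forall n, (forall k, (k < n)%N -> forall A : {set 'I_N}, #|A| = k ->
     #|smooth_perms m A|%:R = k`!%:R * perm_smooth_prob R N m k) ->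
   (0 < n)%N -> forall A : {set 'I_N}, #|A| = n ->
   n%:R * #|smooth_perms m A|%:R = n`!%:R *
       \sum_(d < n) upto R m d.+1 * perm_smooth_prob R N m (n - d.+1)%N.
  move=> {}n IH n0 A An.
  have [a aA] : exists a, a \in A by apply/card_gt0P; rewrite An.
  have -> : n`!%:R = n%:R * (n.-1)`!%:R :> R.
    by rewrite -natrM -{2}(prednK n0) -factS prednK.
  rewrite (card_smooth_marked m aA) An natr_sum -[RHS]mulrA; congr (_ * _).
  rewrite mulr_sumr big_mkcond /=.
  apply: eq_bigr => d _; rewrite /upto; case: ifP => dm; last by rewrite mul0r mulr0.
  rewrite mul1r (@card_marked R _ m (perm_smooth_prob R N m) n.-1) ?An //.
    by move=> B Bn; apply: IH => //; lia.
  by have := ltn_ord d; lia.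
have main k (A : {set 'I_N}) : #|A| = k ->
    #|smooth_perms m A|%:R = k`!%:R * perm_smooth_prob R N m k.
  elim/ltn_ind: k A => {}n IH A An.
  have fn0 : n`!%:R != 0 :> R by rewrite pnatr_eq0 -lt0n fact_gt0.
  rewrite /perm_smooth_prob mulrC divfK //.
  have cI : #|[set i : 'I_N | (i < n)%N]| = n.
    have nN : (n <= N)%N by rewrite -An -[leqRHS]card_ord max_card.
    rewrite -[RHS]card_ord -sum1_card -[RHS]sum1_card.
    by rewrite (big_ord_widen N (fun=> 1%N)) //; apply: eq_bigl => i; rewrite inE.
  case: (posnP n) => [n0|n0].
    by congr (#|smooth_perms m _|%:R); rewrite (cards0_eq (etrans An n0)) n0;
       apply/setP => i; rewrite !inE.
  have n0R : n%:R != 0 :> R by rewrite pnatr_eq0 -lt0n.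
  by apply: (mulfI n0R); rewrite (key n) // (key n).
move=> A An; split=> [|n0]; first exact: main.
have fn0 : n`!%:R != 0 :> R by rewrite pnatr_eq0 -lt0n fact_gt0.
apply: (mulfI fn0); rewrite mulrCA -(main _ A An).
by apply: key => // k kn B; apply: main.
Qed.

Lemma perm_smooth_rec (R : realType) N m : (0 < m)%N ->
  log_deriv_rec N (upto R m) (perm_smooth_prob R N m).
Proof.
move=> m0; split.
  rewrite /perm_smooth_prob fact0 divr1 (_ : smooth_perms _ _ = [set 1%g]) ?cards1 //.
  apply/setP => s; rewrite !inE; apply/andP/eqP => [[onA _]|->].
    apply: (perm_on_id onA); rewrite (_ : [set i : 'I_N | (i < 0)%N] = set0) ?cards0 //.
  split; first exact: perm_on1.
  by apply/forallP => x; rewrite porbit_fixed ?perm1 // cards1.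
move=> n /andP[n0 nN].
have cI : #|[set i : 'I_N | (i < n)%N]| = n.
  rewrite -[RHS]card_ord -sum1_card -[RHS]sum1_card.
  by rewrite (big_ord_widen N (fun=> 1%N)) //; apply: eq_bigl => i; rewrite inE.
by have [_ ->] := card_smooth_perms R m0 cI.
Qed.

Lemma longest_cycle_le n m (s : 'S_n) : (longest_cycle s <= m)%N = cycles_le m s.
Proof.
apply/bigmax_leqP/forallP => [sm x|sm O /imsetP[x _ ->]]; last exact: sm.
exact/sm/imset_f.
Qed.

Lemma perm_smooth_probE (R : realType) n m :
  #|[set s in [set: 'S_n] | (longest_cycle s <= m)%N]|%:R / #|[set: 'S_n]|%:R
  = perm_smooth_prob R n m n.
Proof.
rewrite /perm_smooth_prob cardsT card_Sn; congr (#|pred_of_set _|%:R / _).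
apply/setP => s; rewrite !inE longest_cycle_le [RHS]andb_idl // => _.
by apply/subsetP => x _; rewrite inE ltn_ord.
Qed.

(** * Irreducible factors of polynomials over a finite field *)

Lemma irreducible_coprimeVdvd (F : fieldType) (P f : {poly F}) :
  irreducible_poly P -> coprimep P f || (P %| f).
Proof.
move=> irrP; case: (irredp_XsubCP irrP (dvdp_gcdl P f)) => [g1|gP].
  by rewrite -gcdp_eqp1 g1.
by rewrite -(eqp_dvdl _ gP) dvdp_gcdr orbT.
Qed.

Lemma irreducible_dvd_mul (F : fieldType) (P f g : {poly F}) :
  irreducible_poly P -> (P %| f * g) = (P %| f) || (P %| g).
Proof.
move=> irrP; apply/idP/orP => [|[]]; [|exact: dvdp_mulr|exact: dvdp_mull].
have /orP[cop|] := irreducible_coprimeVdvd f irrP; last by left.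
by rewrite Gauss_dvdpr //; right.
Qed.

Lemma irreducible_dvd_eqp (F : fieldType) (P Q : {poly F}) :
  irreducible_poly P -> irreducible_poly Q -> P %| Q -> P %= Q.
Proof.
move=> [sP _] [_ irrQ] PQ; apply: irrQ => //.
by move: sP; case: eqP => // ->.
Qed.

Lemma exists_irreducible_factor (F : finFieldType) (f : {poly F}) :
  (1 < size f)%N ->
  exists P : {poly F}, [/\ P \is monic, irreducible_poly P & P %| f].
Proof.
move: {2}(size f) (leqnn (size f)) => n.
elim: n f => [|n IH] f sfn sf; first by lia.
have f0 : f != 0 by rewrite -size_poly_gt0; lia.
have lf0 : lead_coef f != 0 by rewrite lead_coef_eq0.
case irrf : (irreducibleb f).
  exists ((lead_coef f)^-1 *: f); have li0 : (lead_coef f)^-1 != 0 by rewrite invr_eq0.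
  split; last by rewrite dvdpZl.
    by rewrite monicE lead_coefZ mulVf.
  have [_ irr] := irreducibleP _ irrf.
  split; first by rewrite size_scale.
  move=> d sd; rewrite dvdpZr // => /(irr _ sd) /eqp_trans; apply.
  by rewrite eqp_sym eqp_scale.
move: irrf; rewrite /irreducibleb /= sf /= => /negbT /forallPn[/= d].
rewrite negb_imply -ltnNge => /andP[df sd].
have df' : d %| f by rewrite -Pdiv.Idomain.dvdpE in df.
have [|//|P [mP irrP Pd]] := IH d; first by apply: (leq_trans (size_npoly d)); rewrite -ltnS prednK // ltnW.
by exists P; split => //; apply: dvdp_trans Pd df'.
Qed.

Lemma max_irr_degreeP (F : finFieldType) (m : nat) (f : {poly F}) : f != 0 ->
  reflect (forall P : {poly F}, irreducible_poly P -> P %| f -> ((size P).-1 <= m)%N)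
          (max_irr_degree f <= m)%N.
Proof.
move=> f0; apply: (iffP (bigmax_leqP _ _ _)) => [sm P irrP Pf|sm P].
  have sP : (size P <= size f)%N by apply: dvdp_leq.
  by apply: (sm (NPoly (sP : P \is a poly_of_size (size f)))); rewrite /= Pf andbT;
     apply/irreducibleP.
by case/andP => /irreducibleP; apply: sm.
Qed.

Lemma max_irr_degree_mul (F : finFieldType) m (f g : {poly F}) : f != 0 -> g != 0 ->
  (max_irr_degree (f * g) <= m)%N = (max_irr_degree f <= m)%N && (max_irr_degree g <= m)%N.
Proof.
move=> f0 g0; have fg0 : f * g != 0 by rewrite mulf_neq0.
apply/max_irr_degreeP/andP => // [sm|[/max_irr_degreeP smf /max_irr_degreeP smg] P irrP].
  by split; apply/max_irr_degreeP => // P irrP Pf; apply: sm;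
    rewrite // irreducible_dvd_mul // Pf ?orbT.
by rewrite irreducible_dvd_mul // => /orP[]; [apply: smf|apply: smg].
Qed.

Lemma max_irr_degree1 (F : finFieldType) m : (max_irr_degree (1 : {poly F}) <= m)%N.
Proof.
apply/max_irr_degreeP => [|P [sP _] /dvdp_leq]; first exact: oner_neq0.
by rewrite oner_neq0 size_poly1 => /(_ isT); lia.
Qed.

Lemma max_irr_degree_irr (F : finFieldType) m k (P : {poly F}) : irreducible_poly P ->
  (max_irr_degree (P ^+ k.+1) <= m)%N = ((size P).-1 <= m)%N.
Proof.
move=> irrP; have P0 := irredp_neq0 irrP.
apply/idP/idP => [|sm].
  rewrite exprS max_irr_degree_mul ?expf_neq0 // => /andP[/max_irr_degreeP h _].
  by apply: h.
elim: k.+1 => [|j IH]; first by rewrite expr0 max_irr_degree1.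
rewrite exprS max_irr_degree_mul ?expf_neq0 // IH andbT.
by apply/max_irr_degreeP => // Q irrQ /(irreducible_dvd_eqp irrQ irrP)/eqp_size->.
Qed.

Definition irr_monics (F : finFieldType) (N : nat) : {set {poly_N.+1 F}} :=
  [set P : {poly_N.+1 F} | ((P : {poly F}) \is monic) && irreducibleb P].

Lemma irr_monicsP (F : finFieldType) N (P : {poly_N.+1 F}) :
  reflect ((P : {poly F}) \is monic /\ irreducible_poly P) (P \in irr_monics F N).
Proof. by rewrite inE; apply: (iffP andP) => -[? /irreducibleP]. Qed.

(** Unique factorization in the form deg f = sum over P of deg P * v_P(f), where
    v_P(f) counts the j >= 1 such that P^j divides f.  Removing one irreducible
    factor Q from f lowers v_Q by one and no other valuation. *)
Lemma degree_sum_irr (F : finFieldType) N (f : {poly F}) :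
  f \is monic -> (size f <= N.+1)%N ->
  (size f).-1 = (\sum_(P in irr_monics F N) \sum_(j < N)
     (size P).-1 * (((P : {poly F}) ^+ j.+1)%R %| f)%R)%N.
Proof.
move: {2}(size f) (leqnn (size f)) => n.
elim: n f => [|n IH] f sfn mf sf.
  by move: sfn; rewrite size_poly_leq0 (negPf (monic_neq0 mf)).
have [sf1|sf1] := leqP (size f) 1.
  have sz1 : size f = 1%N.
    by apply/eqP; rewrite eqn_leq sf1 size_poly_gt0 monic_neq0.
  rewrite big1 ?sz1 // => P /irr_monicsP[mP irrP]; rewrite big1 // => j _.
  rewrite (_ : _ %| f = false) ?muln0 //; apply/negP.
  move=> /(dvdp_trans (dvdp_exp (ltn0Sn j) (dvdpp P))) /dvdp_leq.
  by rewrite monic_neq0 // sz1 leqNgt irrP.1 => /(_ isT).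
have [Q [mQ irrQ Qf]] := exists_irreducible_factor sf1.
have [sQ1 _] := irrQ.
have f0 := monic_neq0 mf.
have sQN : (size Q <= N.+1)%N by apply: leq_trans sf; apply: dvdp_leq.
pose Q' : {poly_N.+1 F} := NPoly (sQN : Q \is a poly_of_size N.+1).
have Q'irr : Q' \in irr_monics F N by apply/irr_monicsP.
move: Qf; rewrite dvdp_eq => /eqP fE.
pose h : {poly F} := f %/ Q; rewrite -/h in fE.
have mh : h \is monic by move: mf; rewrite fE monicMr.
have [e eE] : exists e, size Q = e.+2.
  by move: sQ1; case: (size Q) => [|[|e]] // _; exists e.
have [d dE] : exists d, size h = d.+1.
  by have := size_poly_gt0 h; rewrite monic_neq0 //; case: (size h) => // d _; exists d.
have szf : size f = (e.+1 + d.+1)%N.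
  by rewrite fE size_Mmonic ?monic_neq0 // eE dE addnS addnC.
have sh : (size h <= n)%N by move: sfn; rewrite szf dE; lia.
have hN : (size h <= N)%N by move: sf; rewrite szf dE; lia.
rewrite szf (bigD1 Q') //= eE.
have := IH h sh mh (leqW hN); rewrite (bigD1 Q') //= eE => IHh.
have -> : (\sum_(P in irr_monics F N | P != Q') \sum_(j < N)
     (size P).-1 * (((P : {poly F}) ^+ j.+1)%R %| f)%R =
   \sum_(P in irr_monics F N | P != Q') \sum_(j < N)
     (size P).-1 * (((P : {poly F}) ^+ j.+1)%R %| h)%R)%N.
  apply: eq_bigr => P /andP[/irr_monicsP[mP irrP] PQ].
  apply: eq_bigr => j _; congr (_ * nat_of_bool _)%N; rewrite fE Gauss_dvdpl //.
  apply: coprimep_expl; have /orP[//|/(irreducible_dvd_eqp irrP irrQ)] :=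
    irreducible_coprimeVdvd Q irrP.
  by rewrite eqp_monic // => /eqP PQE; case/eqP: PQ; apply: val_inj.
have -> : (\sum_(j < N) e.+1 * (Q ^+ j.+1 %| f)%R =
   e.+1 + \sum_(j < N) e.+1 * (Q ^+ j.+1 %| h)%R)%N.
  rewrite (eq_bigr (fun j : 'I_N => e.+1 * (Q ^+ j %| h)%R))%N => [|j _]; last first.
    by rewrite fE exprSr dvdp_mul2r // monic_neq0.
  (* shifting j by one exposes the new power j = 0; the power Q ^+ N at the other
     end is too large to divide h *)
  have N0 : (0 < N)%N by move: hN; rewrite dE; lia.
  rewrite -(prednK N0) [LHS]big_ord_recl [in RHS]big_ord_recr /= dvd1p muln1.
  rewrite (_ : Q ^+ _ %| h = false) ?muln0 ?addn0 //.
  apply/negP => /dvdp_leq; rewrite monic_neq0 // => /(_ isT).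
  have := size_exp Q N.-1.+1; rewrite (prednK N0) eE dE.
  have := size_poly_gt0 (Q ^+ N); rewrite monic_neq0 ?monic_exp //.
  by case: (size (Q ^+ N)) => // k _ /=; move: hN; rewrite dE; nia.
by rewrite -addnA -IHh dE addnS.
Qed.

(** * Counting smooth polynomials *)

Definition smooth_polys (F : finFieldType) (m n : nat) : {set {poly_n.+1 F}} :=
  [set f in monic_polys F n | (max_irr_degree f <= m)%N].

Lemma smooth_polysP (F : finFieldType) m n (f : {poly_n.+1 F}) :
  reflect [/\ (f : {poly F}) \is monic, size f = n.+1 & (max_irr_degree f <= m)%N]
          (f \in smooth_polys F m n).
Proof. by rewrite !inE -andbA; apply: (iffP and3P) => -[? /eqP]. Qed.

Lemma card_smooth_polys0 (F : finFieldType) m : #|smooth_polys F m 0| = 1%N.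
Proof.
have s1 : (1 : {poly F}) \is a poly_of_size 1 by rewrite qualifE /= size_poly1.
rewrite (_ : smooth_polys F m 0 = [set NPoly s1]) ?cards1 //.
apply/setP => f; rewrite in_set1; apply/smooth_polysP/eqP => [[mf sf _]|->].
  apply: val_inj => /=; have := monicP mf.
  by rewrite (size1_polyC (_ : size f <= 1)%N) ?sf // lead_coefC => ->.
by rewrite /= monic1 size_poly1 max_irr_degree1.
Qed.

Lemma card_monic_polys (F : finFieldType) n : #|monic_polys F n| = (#|F| ^ n)%N.
Proof.
have sX (g : {poly_n F}) : 'X^n + (g : {poly F}) \is a poly_of_size n.+1.
  rewrite qualifE /= (leq_trans (size_polyD _ _)) // geq_max size_polyXn leqnn.
  exact: leqW (size_npoly g).
rewrite -card_npoly -(card_imset _ (_ : injective (fun g => NPoly (sX g)))); last first.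
  by move=> g1 g2 [] /addrI /val_inj.
apply: eq_card => f; rewrite inE; apply/andP/imsetP => [[mf /eqP sf]|[g _ ->]] /=.
  have sg : (f : {poly F}) - 'X^n \is a @poly_of_size F n.
    rewrite qualifE /=; apply/leq_sizeP => j; rewrite leq_eqVlt => /orP[/eqP<-|nj].
      by rewrite coefB coefXn eqxx; have := monicP mf; rewrite /lead_coef sf => ->; rewrite subrr.
    by rewrite coefB coefXn gtn_eqF // subr0 nth_default // sf.
  by exists (NPoly sg) => //; apply: val_inj; rewrite /= addrC subrK.
have sz : size ('X^n + (g : {poly F})) = n.+1.
  by rewrite size_polyDl size_polyXn // ltnS size_npoly.
split; last by rewrite sz.
by rewrite monicE lead_coefDl ?lead_coefXn // size_polyXn ltnS size_npoly.
Qed.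

Lemma smooth_polys_all (F : finFieldType) m n : (n <= m)%N ->
  smooth_polys F m n = monic_polys F n.
Proof.
move=> nm; apply/setP => f; rewrite !inE; apply: andb_idr => /andP[mf /eqP sf].
apply/max_irr_degreeP => [|P _ /dvdp_leq]; rewrite monic_neq0 // sf => /(_ isT).
by case: (size P) => //= k; rewrite ltnS => /leq_trans; apply.
Qed.

(** The multiples of P^(k+1) are the products P^(k+1) h, and such a product is
    smooth exactly when P and h are. *)
Lemma card_smooth_dvd (F : finFieldType) N m n k (P : {poly_N.+1 F}) :
  P \in irr_monics F N ->
  #|[set f in smooth_polys F m n | ((P : {poly F}) ^+ k.+1 %| f)]| =
  (if ((size P).-1 <= m)%N && (k.+1 * (size P).-1 <= n)%N
   then #|smooth_polys F m (n - k.+1 * (size P).-1)| else 0)%N.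
Proof.
move=> /irr_monicsP[mP irrP]; set e := (size P).-1.
have mPk : (P : {poly F}) ^+ k.+1 \is monic by rewrite monic_exp.
have sPk : size ((P : {poly F}) ^+ k.+1) = (k.+1 * e).+1.
  have := size_exp (P : {poly F}) k.+1; rewrite -/e mulnC => <-.
  by rewrite prednK // size_poly_gt0 monic_neq0.
have factorE (f : {poly F}) : f \is monic -> (P : {poly F}) ^+ k.+1 %| f ->
    exists h : {poly F}, [/\ h \is monic, f = (P : {poly F}) ^+ k.+1 * h
      & size f = (k.+1 * e + size h)%N].
  move=> mf; rewrite dvdp_eq => /eqP fE; set h := f %/ _ in fE.
  have mh : h \is monic by move: mf; rewrite fE monicMr.
  exists h; split=> //; first by rewrite mulrC.
  by rewrite fE size_Mmonic ?monic_neq0 // sPk addnS addnC.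
case: ifP => [/andP[em kn]|kmn]; last first.
  apply: eq_card0 => f; rewrite inE; apply/negP => /andP[/smooth_polysP[mf sf smf] Pf].
  have [h [mh fE szf]] := factorE _ mf Pf.
  move/negP: kmn; apply; apply/andP; split.
    move: smf; rewrite fE max_irr_degree_mul ?monic_neq0 //.
    by rewrite max_irr_degree_irr // => /andP[].
  by have := size_poly_gt0 h; rewrite monic_neq0 //; move: szf; rewrite sf; lia.
set r := (n - _)%N.
have sPh (h : {poly_r.+1 F}) : (size ((P : {poly F}) ^+ k.+1 * (h : {poly F}))%R <= n.+1)%N.
  apply: leq_trans (size_polyMleq _ _) _; rewrite sPk.
  by have := size_npoly h; move: (size h) => sz; rewrite /r; lia.
pose mulP (h : {poly_r.+1 F}) : {poly_n.+1 F} :=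
  NPoly (sPh h : _ \is a poly_of_size n.+1).
have injM : injective mulP.
  move=> h1 h2 [] /(mulfI (monic_neq0 mPk)); exact: val_inj.
rewrite -(card_imset _ injM); apply: eq_card => f.
rewrite inE; apply/andP/imsetP => [[/smooth_polysP[mf sf smf] Pf]|[h /smooth_polysP[mh sh smh] ->]].
  have [h [mh fE szf]] := factorE _ mf Pf.
  have sh : size h = r.+1 by move: szf; rewrite sf /r; lia.
  exists (NPoly (eq_leq sh : h \is a poly_of_size r.+1)); last exact: val_inj.
  apply/smooth_polysP; split=> //=.
  by move: smf; rewrite fE max_irr_degree_mul ?monic_neq0 // => /andP[].
split; last exact: dvdp_mulr.
apply/smooth_polysP; split => /=; first by rewrite monicMl.
  by rewrite size_Mmonic ?monic_neq0 // sPk sh /r; lia.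
by rewrite max_irr_degree_mul ?monic_neq0 // smh andbT max_irr_degree_irr.
Qed.

(** The sum over monic g of degree d of the von Mangoldt function, restricted to
    powers of irreducibles of degree at most m; N only bounds the degrees, to have
    a finite index type. *)
Definition smooth_mangoldt (F : finFieldType) (N m d : nat) : nat :=
  (\sum_(P in irr_monics F N | ((size P).-1 <= m)%N && ((size P).-1 %| d)%N) (size P).-1)%N.

Lemma sum_multiples N n e (G : nat -> nat) : (0 < e)%N -> (n <= N)%N ->
  (\sum_(j < N) (if j.+1 * e <= n then G (n - j.+1 * e) else 0) =
   \sum_(d < n) (e %| d.+1) * G (n - d.+1))%N.
Proof.
move=> e0 nN.
transitivity (\sum_(j < N) \sum_(d < n) (d.+1 == j.+1 * e) * G (n - d.+1))%N.
  apply: eq_bigr => j _; case: ifP => jn.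
    have dn : ((j.+1 * e).-1 < n)%N by lia.
    rewrite (bigD1 (Ordinal dn)) //= big1 => [|d /eqP dne].
      by rewrite prednK ?muln_gt0 ?e0 // eqxx mul1n addn0.
    case: eqP => // dE; case: dne; apply: val_inj => /=; lia.
  by rewrite big1 // => d _; case: eqP => // dE; have := ltn_ord d; lia.
rewrite exchange_big; apply: eq_bigr => d _; rewrite -big_distrl /=; congr (_ * _)%N.
case: dvdnP => [[[|k] dE]|ndE]; first by lia.
  have kN : (k < N)%N by have := ltn_ord d; nia.
  rewrite (bigD1 (Ordinal kN)) //= dE eqxx big1 // => j /eqP jk.
  case: eqP => // /eqP; rewrite eqn_pmul2r // => /eqP[kj].
  by case: jk; apply: val_inj.
by rewrite big1 // => j _; case: eqP => // dE; case: ndE; exists j.+1.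
Qed.

(** Double counting of the sum of deg f over the smooth f of degree n, by
    [degree_sum_irr]; the pairs (P, j) are grouped by d = j deg P. *)
Lemma smooth_polys_rec (F : finFieldType) N m n : (0 < n <= N)%N ->
  (n * #|smooth_polys F m n| =
   \sum_(d < n) smooth_mangoldt F N m d.+1 * #|smooth_polys F m (n - d.+1)|)%N.
Proof.
move=> /andP[n0 nN].
transitivity (\sum_(f in smooth_polys F m n) \sum_(P in irr_monics F N) \sum_(j < N)
     (size P).-1 * ((P : {poly F}) ^+ j.+1 %| f)%R)%N.
  rewrite mulnC -sum_nat_const.
  apply: eq_bigr => f /smooth_polysP[mf sf _].
  by rewrite -degree_sum_irr // sf.
rewrite exchange_big /=.
transitivity (\sum_(P in irr_monics F N | ((size P).-1 <= m)%N)
   \sum_(d < n) (size P).-1 * (((size P).-1 %| d.+1) * #|smooth_polys F m (n - d.+1)|))%N.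
  rewrite [RHS]big_mkcondr; apply: eq_bigr => P PI.
  rewrite exchange_big /=.
  have [mP [sP _]] := irr_monicsP _ PI.
  transitivity (\sum_(j < N) (size P).-1 *
      #|[set f in smooth_polys F m n | ((P : {poly F}) ^+ j.+1 %| f)%R]|)%N.
    apply: eq_bigr => j _; rewrite -big_distrr /=; congr (_ * _)%N.
    rewrite -sum1_card [RHS]big_mkcond [LHS]big_mkcond; apply: eq_bigr => f _.
    by rewrite inE; case: (f \in _).
  rewrite -!big_distrr /=; case: ifP => em; last first.
    by rewrite big1 ?muln0 // => j _; rewrite card_smooth_dvd // em.
  have e0 : (0 < (size P).-1)%N by move: sP; case: (size P) => [|[]].
  rewrite -(sum_multiples (fun r => #|smooth_polys F m r|) e0 nN).
  by congr (_ * _)%N; apply: eq_bigr => j _; rewrite card_smooth_dvd // em.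
rewrite exchange_big /=; apply: eq_bigr => d _; rewrite /smooth_mangoldt.
rewrite big_distrl /= [RHS]big_mkcond [LHS]big_mkcond; apply: eq_bigr => P _.
by case: (P \in _) => //=; case: (_ <= m)%N => //=; case: (_ %| _)%N; rewrite ?muln0 ?mul1n.
Qed.

(** Gauss's formula.  For m = N every polynomial is smooth, so the counts are q^n and
    the recurrence determines its weights. *)
Lemma mangoldt_full (F : finFieldType) N d : (0 < d <= N)%N ->
  smooth_mangoldt F N N d = (#|F| ^ d)%N.
Proof.
elim/ltn_ind: d => -[//|d] IH dN.
have q0 : (0 < #|F|)%N by apply/card_gt0P; exists 0.
have := @smooth_polys_rec F N N d.+1 dN.
rewrite big_ord_recr /= subnn card_smooth_polys0 muln1.
rewrite smooth_polys_all ?card_monic_polys; last by lia.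
rewrite (eq_bigr (fun=> #|F| ^ d.+1)%N) => [|i _].
  by rewrite sum_nat_const card_ord mulSn addnC => /addnI->.
have id := ltn_ord i; rewrite IH; [|lia|lia].
rewrite smooth_polys_all ?card_monic_polys -?expnD; last by lia.
by congr (_ ^ _)%N; lia.
Qed.

Lemma mangoldt_le (F : finFieldType) N m d : (0 < d <= N)%N ->
  (smooth_mangoldt F N m d <= #|F| ^ d)%N.
Proof.
move=> dN; rewrite -(mangoldt_full F dN) /smooth_mangoldt big_mkcond [leqRHS]big_mkcond.
apply: leq_sum => P _; case: (P \in _) => //=.
have -> : ((size P).-1 <= N)%N by have := size_npoly P; case: (size P).
by case: (_ <= m)%N.
Qed.

Lemma mangoldt_eq (F : finFieldType) N m d : (0 < d <= N)%N -> (d <= m)%N ->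
  smooth_mangoldt F N m d = (#|F| ^ d)%N.
Proof.
move=> dN dm; rewrite -(mangoldt_full F dN) /smooth_mangoldt.
apply: eq_bigl => P; case: (P \in _) => //=; case Pd: (_ %| d)%N; rewrite ?andbF //.
have Pled : ((size P).-1 <= d)%N by apply: dvdn_leq Pd; lia.
by rewrite (leq_trans Pled dm) (leq_trans Pled) //; lia.
Qed.

(** Here deg P <= m < d is a proper divisor of d, hence at most d/2, and each such P
    is counted by Gauss's formula at k = deg P. *)
Lemma mangoldt_gt (F : finFieldType) N m d : (m < d <= N)%N ->
  (smooth_mangoldt F N m d <= \sum_(k < d./2) #|F| ^ k.+1)%N.
Proof.
move=> /andP[md dN].
apply: (@leq_trans (\sum_(k < d./2) smooth_mangoldt F N N k.+1)); last first.
  apply: leq_sum => k _; rewrite mangoldt_full //.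
  by have := ltn_ord k; have := half_leq (leqnn d); lia.
rewrite /smooth_mangoldt.
under [leqRHS]eq_bigr do rewrite big_mkcondr.
rewrite exchange_big /= big_mkcondr; apply: leq_sum => P PI.
case: ifP => // /andP[Pm /dvdnP[[|[|c]] dE]]; [by lia|by lia|].
have [mP [sP _]] := irr_monicsP _ PI.
have e0 : (0 < (size P).-1)%N by move: sP; case: (size P) => [|[]].
have ed : ((size P).-1.-1 < d./2)%N by move: ((size P).-1) e0 dE => e; lia.
rewrite (bigD1 (Ordinal ed)) //= prednK // dvdnn andbT.
have mN : (m <= N)%N by lia.
by rewrite (leq_trans Pm mN) leq_addr.
Qed.

(** The polynomial X contributes. *)
Lemma mangoldt_gt0 (F : finFieldType) N m d : (0 < m)%N -> (0 < N)%N ->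
  (0 < smooth_mangoldt F N m d)%N.
Proof.
move=> m0 N0.
have sX : ('X : {poly F}) \is a poly_of_size N.+1 by rewrite qualifE /= size_polyX.
rewrite /smooth_mangoldt (bigD1 (NPoly sX)) //= ?size_polyX //.
apply/andP; split; last by rewrite m0 dvd1n.
apply/irr_monicsP; split=> /=; first exact: monicX.
by have := irredp_XsubC (0 : F); rewrite subr0.
Qed.

(** * Smoothness probabilities and the difference of expectations *)

(** Outside 1..N, where the recurrence says nothing, the weight is that of
    permutations, so that comparisons between the two hold for every index. *)
Definition poly_weight (R : realType) (F : finFieldType) (N m d : nat) : R :=
  if (0 < d <= N)%N then (smooth_mangoldt F N m d)%:R / (#|F| ^ d)%:R else upto R m d.

Definition poly_smooth_prob (R : realType) (F : finFieldType) (m n : nat) : R :=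
  #|smooth_polys F m n|%:R / (#|F| ^ n)%:R.

Lemma poly_smooth_rec (R : realType) (F : finFieldType) N m :
  log_deriv_rec N (poly_weight R F N m) (poly_smooth_prob R F m).
Proof.
have q0 : (0 < #|F|)%N by apply/card_gt0P; exists 0.
have qn0 n : (#|F| ^ n)%:R != 0 :> R by rewrite pnatr_eq0 -lt0n expn_gt0 q0.
split; first by rewrite /poly_smooth_prob card_smooth_polys0 expn0 divr1.
move=> n nN; rewrite /poly_smooth_prob mulrA -natrM (smooth_polys_rec F m nN).
rewrite natr_sum mulr_suml; apply: eq_bigr => d _.
have dn := ltn_ord d; rewrite /poly_weight ifT; last by lia.
have -> : (#|F| ^ n)%:R = (#|F| ^ d.+1)%:R * (#|F| ^ (n - d.+1))%:R :> R.
  by rewrite -natrM -expnD subnKC.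
by rewrite natrM invfM mulrACA.
Qed.

Lemma upto_le_poly_weight (R : realType) (F : finFieldType) N m d :
  0 <= upto R m d <= poly_weight R F N m d.
Proof.
have q0 : (0 < #|F|)%N by apply/card_gt0P; exists 0.
have qd : 0 < (#|F| ^ d)%:R :> R by rewrite ltr0n expn_gt0 q0.
have /andP[-> _] := upto_itv R m d; rewrite /poly_weight; case: ifP => //= dN.
have [dm|md] := leqP d m; last by rewrite /upto leqNgt md divr_ge0.
by rewrite mangoldt_eq // divff ?gt_eqF // /upto dm.
Qed.

Lemma poly_weight_itv (R : realType) (F : finFieldType) N m d :
  0 <= poly_weight R F N m d <= 1.
Proof.
have /andP[u0 u1] := upto_le_poly_weight R F N m d; rewrite (le_trans u0 u1) /=.
rewrite /poly_weight; case: ifP => dN; last by case/andP: (upto_itv R m d).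
have q0 : (0 < #|F|)%N by apply/card_gt0P; exists 0.
by rewrite ler_pdivrMr ?ltr0n ?expn_gt0 ?q0 // mul1r ler_nat mangoldt_le.
Qed.

Lemma poly_weight_eq1 (R : realType) (F : finFieldType) N m d : (0 < d <= m)%N ->
  poly_weight R F N m d = 1.
Proof.
move=> /andP[d0 dm]; rewrite /poly_weight; case: ifP => dN; last by rewrite /upto dm.
have q0 : (0 < #|F|)%N by apply/card_gt0P; exists 0.
by rewrite mangoldt_eq // divff // pnatr_eq0 -lt0n expn_gt0 q0.
Qed.

Lemma uniform_mean_tail (R : realType) (T : finType) (A : {set T}) (X : T -> nat) n :
  (0 < #|A|)%N -> (forall x, x \in A -> (X x <= n)%N) ->
  uniform_mean A (fun x => (X x)%:R) =
    n%:R - \sum_(m < n) #|[set x in A | (X x <= m)%N]|%:R / #|A|%:R :> R.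
Proof.
move=> A0 Xn; have A0R : #|A|%:R != 0 :> R by rewrite pnatr_eq0 -lt0n.
apply: (canLR (mulfK A0R)); rewrite mulrBl mulr_suml.
have -> : n%:R * #|A|%:R = \sum_(x in A) n%:R :> R.
  by rewrite sumr_const mulrC mulr_natl.
rewrite (eq_bigr (fun m : 'I_n => \sum_(x in A) (X x <= m)%N%:R)) => [|m _]; last first.
  rewrite divfK // -sum1_card natr_sum [LHS]big_mkcond [RHS]big_mkcond /=.
  by apply: eq_bigr => x _; rewrite inE; case: (x \in A); case: (_ <= _)%N.
rewrite exchange_big -sumrB /=; apply: eq_bigr => x /Xn Xxn.
rewrite -natr_sum -natrB; last first.
  rewrite -[leqRHS]card_ord -sum1_card; apply: leq_sum => m _; exact: leq_b1.
congr _%:R; apply/eqP; rewrite eq_sym -(eqn_add2r (\sum_(m < n) (X x <= m))%N) subnK; last first.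
  rewrite -[leqRHS]card_ord -sum1_card; apply: leq_sum => m _; exact: leq_b1.
have -> : (\sum_(m < n) (X x <= m) = n - X x)%N.
  elim: n {Xn} Xxn => [|k IH]; first by rewrite leqn0 big_ord0 => /eqP->.
  rewrite leq_eqVlt big_ord_recr /= => /orP[/eqP->|]; last first.
    by rewrite ltnS => Xk; rewrite IH // Xk addn1 subSn.
  by rewrite ltnn subnn addn0 big1 // => m _; have := ltn_ord m; lia.
by rewrite subnKC.
Qed.

Lemma longest_cycle_gap (R : realType) (F : finFieldType) n : (0 < n)%N ->
  E_longest_cycle R n - E_max_irr_degree R F n =
  \sum_(m < n | (0 < m)%N) (poly_smooth_prob R F m n - perm_smooth_prob R n m n).
Proof.
move=> n0.
have q0 : (0 < #|F|)%N by apply/card_gt0P; exists 0.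
rewrite /E_longest_cycle /E_max_irr_degree (@uniform_mean_tail R _ _ _ n).
- rewrite (@uniform_mean_tail R _ _ _ n).
  + rewrite opprB addrC addrA subrK -sumrB [RHS]big_mkcond /=.
    apply: eq_bigr => m _; rewrite perm_smooth_probE card_monic_polys.
    rewrite -/(smooth_polys F m n) -/(poly_smooth_prob R F m n); case: ifP => // /negbT.
    rewrite -eqn0Ngt => /eqP->; apply/eqP; rewrite subr_eq0; apply/eqP.
    rewrite (_ : perm_smooth_prob R n 0 n = 0); last first.
      rewrite /perm_smooth_prob eq_card0 ?mul0r // => s; rewrite inE.
      apply/negP => /andP[_ /forallP /(_ (Ordinal n0))].
      by rewrite leqNgt card_gt0; case/set0Pn; exists (Ordinal n0); apply: porbit_id.
    rewrite /poly_smooth_prob eq_card0 ?mul0r // => f.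
    apply/negP => /smooth_polysP[mf sf].
    have [|P [mP irrP Pf]] := @exists_irreducible_factor F f; first by rewrite sf.
    move=> /max_irr_degreeP; rewrite monic_neq0 // => /(_ isT _ irrP Pf).
    by have [sP _] := irrP; move: sP; case: (size P) => [|[]].
  + by rewrite card_monic_polys expn_gt0 q0.
  + by move=> f; rewrite -(smooth_polys_all F (leqnn n)) => /smooth_polysP[].
- by rewrite cardsT card_Sn fact_gt0.
move=> s _; rewrite longest_cycle_le; apply/forallP => x.
by rewrite -[leqRHS]card_ord max_card.
Qed.

(** * Bounds for the difference at one smoothness level *)

Lemma expR_ln_nat (R : realType) n k : (0 < n)%N ->
  expR (ln n%:R * k%:R) = (n ^ k)%:R :> R.
Proof. by move=> n0; rewrite expRM_natr lnK ?natrX // posrE ltr0n. Qed.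

Lemma half_le_ln_nat (R : realType) n : (2 <= n)%N -> 2^-1 <= ln n%:R :> R.
Proof.
move=> n2; rewrite -ler_expR lnK ?posrE ?ltr0n; last by lia.
apply: (@le_trans _ _ 2); last by rewrite ler_nat.
have := expR_ge1Dx (- 2^-1 : R); rewrite expRN => h.
have e0 := expR_gt0 (2^-1 : R).
by rewrite -[leLHS]invrK -[leRHS]invrK lef_pV2 ?posrE ?invr_gt0 //; lra.
Qed.

Lemma ln_nat_le (R : realType) n q : (0 < n)%N -> (2 <= q)%N ->
  ln n%:R <= n%:R * ln q%:R :> R.
Proof.
move=> n0 q2; rewrite -ler_expR mulrC expR_ln_nat; last by lia.
rewrite lnK ?posrE ?ltr0n // ler_nat.
exact/ltnW/ltn_expl.
Qed.

(** Bounds the geometric series of ratio q^(-1/4) uniformly in q, as log q >= 1/2. *)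
Definition geom_bound (R : realType) : R := (1 - expR (- 8^-1))^-1.

Lemma geom_bound_gt0 (R : realType) : 0 < geom_bound R.
Proof. by rewrite invr_gt0 subr_gt0 expR_lt1 oppr_lt0 invr_gt0. Qed.

Lemma sum_expR_le (R : realType) (l : R) N : 2^-1 <= l ->
  \sum_(d < N) expR (- (l / 4 * d.+1%:R)) <= geom_bound R.
Proof.
move=> l2; set x : R := expR (- 8^-1).
have x0 : 0 <= x by apply: expR_ge0.
have x1 : 0 < 1 - x by rewrite subr_gt0 expR_lt1 oppr_lt0 invr_gt0.
apply: (@le_trans _ _ (\sum_(d < N) x ^+ d)).
  apply: ler_sum => d _; rewrite -expRM_natr ler_expR mulNr lerN2.
  by apply: ler_pM; [lra|by []|lra|rewrite ler_nat ltnW].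
rewrite -(ler_pM2l x1) /geom_bound divff ?gt_eqF //.
have -> : (1 - x) * \sum_(d < N) x ^+ d = 1 - x ^+ N.
  by rewrite -[RHS]opprB subrX1 -mulNr opprB.
by rewrite gerBl exprn_ge0.
Qed.

Lemma sum_expn_le q K : (2 <= q)%N -> (\sum_(k < K) q ^ k.+1 <= 2 * q ^ K)%N.
Proof.
move=> q2; elim: K => [|K IH]; first by rewrite big_ord0.
rewrite big_ord_recr /= mul2n -addnn leq_add2r (leq_trans IH) //.
by rewrite expnS leq_mul2r q2 orbT.
Qed.

Lemma poly_weight_upper (R : realType) (F : finFieldType) N m d : (2 <= #|F|)%N ->
  (m < d <= N)%N -> poly_weight R F N m d <= 2 * expR (- (ln #|F|%:R / 2 * d%:R)).
Proof.
move=> q2 /andP[md dN]; set q := #|F| in q2 *.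
have q0 : (0 < q)%N by lia.
have l0 : 0 <= ln q%:R :> R by apply: ln_ge0; rewrite ler1n.
rewrite /poly_weight ifT -/q; last by lia.
rewrite ler_pdivrMr ?ltr0n ?expn_gt0 ?q0 //.
apply: (@le_trans _ _ ((2 * q ^ d./2)%:R)).
  by rewrite ler_nat (leq_trans (mangoldt_gt F _)) ?sum_expn_le ?md.
rewrite natrM -(expR_ln_nat R d q0) -(expR_ln_nat R d./2 q0) -[leRHS]mulrA -expRD.
rewrite ler_wpM2l // ler_expR.
have : d./2%:R * 2 <= d%:R :> R.
  by rewrite -natrM ler_nat muln2 -{2}(odd_double_half d) leq_addl.
by nra.
Qed.

Lemma poly_weight_lower (R : realType) (F : finFieldType) N m d :
  (0 < m)%N -> (0 < d <= N)%N -> (#|F| ^ d)%:R^-1 <= poly_weight R F N m d.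
Proof.
move=> m0 dN; rewrite /poly_weight ifT // ler_peMl ?invr_ge0 //.
by rewrite ler1n mangoldt_gt0 //; lia.
Qed.

Definition smooth_gap (R : realType) (F : finFieldType) (n m : nat) : R :=
  poly_smooth_prob R F m n - perm_smooth_prob R n m n.

Lemma smooth_gap_ge0 (R : realType) (F : finFieldType) n m : (0 < m)%N ->
  0 <= smooth_gap R F n m.
Proof.
move=> m0; rewrite subr_ge0.
apply: (log_deriv_rec_le (upto_le_poly_weight R F n m) _ _ (leqnn n)).
  exact: poly_smooth_rec.
exact: perm_smooth_rec.
Qed.

(** The factor 1 / (m+1) is absorbed by m + 1 <= q^m, which is why 3 m rather than
    m + 1 multiplies log q. *)
Lemma smooth_gap_lower (R : realType) (F : finFieldType) n m : (2 <= #|F|)%N ->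
  (0 < m < n)%N ->
  expR (- (3 * m%:R * ln #|F|%:R + n%:R * ln n%:R / m%:R)) <= smooth_gap R F n m.
Proof.
move=> q2 /andP[m0 mn]; set q := #|F| in q2 *.
have q0 : (0 < q)%N by lia.
have n0 : (0 < n)%N by lia.
have l0 : 0 <= ln q%:R :> R by apply: ln_ge0; rewrite ler1n.
have ln0 : 0 <= ln n%:R :> R by apply: ln_ge0; rewrite ler1n.
have := log_deriv_rec_gap (k := m) (n := n - m.+1) (upto_le_poly_weight R F n m)
  (poly_smooth_rec R F n m) (perm_smooth_rec R n m0).
rewrite subnK // leqnn => /(_ isT); apply: le_trans.
rewrite /upto ltnn subr0 opprD expRD ler_pM ?expR_ge0 //.
  rewrite ler_pdivlMr ?ltr0n //.
  apply: le_trans (poly_weight_lower R F m0 (_ : 0 < m.+1 <= n)%N); last by lia.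
  rewrite -/q -expR_ln_nat // -expRN.
  have mq : m.+1%:R <= expR (ln q%:R * m%:R) :> R.
    by rewrite expR_ln_nat // ler_nat ltn_expl.
  apply: le_trans (ler_wpM2l (expR_ge0 _) mq) _.
  rewrite -expRD ler_expR.
  have m1 : 1 <= m%:R :> R by rewrite ler1n.
  by rewrite -natr1; nra.
have nmn : (n - m.+1 <= n)%N by lia.
apply: le_trans (upto_solution_ge m0 (perm_smooth_rec R n m0) nmn n0).
rewrite -natrX -expR_ln_nat // -expRN ler_expR lerN2 [leRHS]mulrAC [leRHS]mulrC.
rewrite ler_wpM2l //.
apply: (@le_trans _ _ (n %/ m)%:R); first by rewrite ler_nat leq_div2r.
by rewrite ler_pdivlMr ?ltr0n // -natrM ler_nat leq_trunc_div.
Qed.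

Lemma error_exponent_ge (R : realType) n q : (2 <= n)%N -> (2 <= q)%N ->
  n%:R <= 4 * error_exponent R n q ^+ 2.
Proof.
move=> n2 q2; have ln2 := half_le_ln_nat R n2; have lq2 := half_le_ln_nat R q2.
rewrite /error_exponent; set l := ln n%:R in ln2 *; set k := ln q%:R in lq2 *.
set s := Num.sqrt _; have n0 : 0 <= n%:R :> R by [].
have s2 : s ^+ 2 = n%:R * l * k by rewrite sqr_sqrtr // !mulr_ge0 //; lra.
have s0 : 0 <= s by apply: sqrtr_ge0.
have sE : s <= Num.max s k by rewrite le_max lexx.
apply: (@le_trans _ _ (4 * s ^+ 2)); last by nra.
have lk : 1 <= 4 * (l * k).
  have : 0 <= (l - 2^-1) * (k - 2^-1) by apply: mulr_ge0; lra.
  by lra.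
have -> : 4 * s ^+ 2 = n%:R * (4 * (l * k)) by rewrite s2; ring.
by rewrite ler_peMr.
Qed.

(** A factor n is harmless: n <= 4 E^2 by [error_exponent_ge], and E^2 is at most a
    constant times exp (E / 32). *)
Lemma natr_le_expR_exponent (R : realType) n q : (2 <= n)%N -> (2 <= q)%N ->
  n%:R <= 16384 * expR (error_exponent R n q / 32).
Proof.
move=> n2 q2; apply: le_trans (error_exponent_ge R n2 q2) _.
set E := error_exponent R n q.
have E0 : 0 <= E.
  by rewrite /E /error_exponent le_max sqrtr_ge0.
have -> : E / 32 = E / 64 + E / 64 by lra.
rewrite expRD; have := expR_ge1Dx (E / 64); set y := expR _; nra.
Qed.

Definition gap_constant (R : realType) : R :=
  2 * geom_bound R + expR (16 * (1 + 2 * geom_bound R) ^+ 2).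

(** The total weight beyond m, half of the decay q^(-d/2) being kept to sum the
    geometric series. *)
Lemma gap_le_large (R : realType) (F : finFieldType) n m : (2 <= #|F|)%N ->
  (0 < m)%N -> 
  smooth_gap R F n m <= 2 * geom_bound R * expR (- (m%:R * ln #|F|%:R / 4)).
Proof.
move=> q2 m0; set q := #|F| in q2 *.
have lq2 := half_le_ln_nat R q2; set k := ln q%:R in lq2 *.
apply: le_trans (gap_le_tail (poly_weight_itv R F n m) (poly_weight_eq1 R F n (m:=m))
   (poly_smooth_rec R F n m) (perm_smooth_rec R n m0) (leqnn n)) _.
apply: (@le_trans _ _ (\sum_(d < n) 2 * expR (- (m%:R * k / 4)) * expR (- (k / 4 * d.+1%:R)))).
  rewrite big_mkcond; apply: ler_sum => d _; case: ifP => md; last first.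
    by rewrite !mulr_ge0 ?expR_ge0.
  have mdn : (m < d.+1 <= n)%N by rewrite ltnS md ltn_ord.
  apply: le_trans (poly_weight_upper R q2 mdn) _.
  rewrite -[leRHS]mulrA -expRD ler_wpM2l // ler_expR -/q -/k.
  have : m%:R <= d.+1%:R :> R by rewrite ler_nat; lia.
  by nra.
rewrite -mulr_sumr mulrAC ler_wpM2r ?expR_ge0 //.
by rewrite ler_wpM2l // sum_expR_le.
Qed.

(** The weights up to m give at most exp (t m) each; beyond m the growth exp (t d)
    is compensated by the decay of the weights, as t <= log q / 8. *)
Lemma weighted_sum_le (R : realType) (F : finFieldType) n m (t w : R) :
  (2 <= #|F|)%N -> (0 < m < n)%N -> 0 <= t -> t <= ln #|F|%:R / 8 -> t * m%:R <= w ->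
  \sum_(d < n) poly_weight R F n m d.+1 * expR (t * d.+1%:R)
    <= m%:R * expR w + 2 * geom_bound R.
Proof.
move=> q2 /andP[m0 mn] t0 tq tm; set q := #|F| in q2 tq *.
have lq2 := half_le_ln_nat R q2; set k := ln q%:R in lq2 tq *.
apply: (@le_trans _ _ (\sum_(d < n) (upto R m d.+1 * expR w
     + 2 * expR (- (k / 4 * d.+1%:R))))).
  apply: ler_sum => d _; rewrite /upto.
  have d0 : 0 <= d.+1%:R :> R by [].
  have [dm|md] := leqP d.+1 m.
    rewrite poly_weight_eq1 // !mul1r ler_wpDr ?mulr_ge0 ?expR_ge0 //.
    rewrite ler_expR (le_trans _ tm) // ler_wpM2l // ler_nat //.
  rewrite mul0r add0r.
  have mdn : (m < d.+1 <= n)%N by rewrite md ltn_ord.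
  apply: le_trans (ler_wpM2r (expR_ge0 _) (poly_weight_upper R q2 mdn)) _.
  rewrite -[leLHS]mulrA -expRD ler_wpM2l // ler_expR -/q -/k.
  by nra.
rewrite big_split /= -mulr_suml -mulr_sumr; apply: lerD; last first.
  by rewrite ler_wpM2l // sum_expR_le.
rewrite ler_wpM2r ?expR_ge0 // /upto -natr_sum ler_nat.
rewrite -[leqRHS]card_ord -sum1_card.
rewrite (big_ord_widen n (fun=> 1%N) (ltnW mn)) [leqRHS]big_mkcond.
by apply: leq_sum => d _; case: (d < m)%N.
Qed.

(** Rankin's method for m below the balance point.  With w = log n / 8 the error
    term t K is O(exp (2 w)) = O(n^(1/4)), which is O(sqrt E). *)
Lemma gap_le_small (R : realType) (F : finFieldType) n m : (2 <= #|F|)%N ->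
  (0 < m < n)%N -> m%:R * ln #|F|%:R < error_exponent R n #|F| ->
  smooth_gap R F n m <= expR (16 * (1 + 2 * geom_bound R) ^+ 2)
     * expR (- (error_exponent R n #|F| / 16)).
Proof.
move=> q2 /andP[m0 mn]; set q := #|F| in q2 *.
have n2 : (2 <= n)%N by lia.
have n0 : (0 < n)%N by lia.
have lq2 := half_le_ln_nat R q2; have ln2 := half_le_ln_nat R n2.
have nq := ln_nat_le R n0 q2.
have nE := error_exponent_ge R n2 q2.
set E := error_exponent R n q in nE * => mE.
set k := ln q%:R in lq2 nq mE; set l := ln n%:R in ln2 nq.
have m1 : 1 <= m%:R :> R by rewrite ler1n.
have nR : 0 < n%:R :> R by rewrite ltr0n.
have E2 : E ^+ 2 = n%:R * l * k.
  have kE : k < E by nra.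
  move: kE; rewrite /E /error_exponent -/k -/l lt_max ltxx orbF => /ltW/max_idPl->.
  by rewrite sqr_sqrtr // !mulr_ge0 //; lra.
have E0 : 0 < E by nra.
pose w := l / 8; pose t := Num.min (k / 8) (w / m%:R).
have t0 : 0 <= t by rewrite le_min !divr_ge0 //; lra.
have tk : t <= k / 8 by rewrite ge_min lexx.
have tm : t * m%:R <= w by rewrite -ler_pdivlMr ?ge_min ?lexx ?orbT //; lra.
have tw : t <= w by nra.
have tn : E / 8 <= t * n%:R.
  have [->|->] : t = k / 8 \/ t = w / m%:R by rewrite /t; case: leP; [left|right].
    suff : E <= n%:R * k by nra.
    rewrite -(@ler_pXn2r _ 2) ?nnegrE //; [|lra|nra].
    by rewrite E2; nra.
  suff : m%:R * E <= n%:R * l.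
    by rewrite mulrAC ler_pdivlMr ?ltr0n // /w; nra.
  have k0 : 0 < k by lra.
  rewrite -(ler_pM2r k0) -E2; nra.
have := @rankin_bound R n _ _ t (m%:R * expR w + 2 * geom_bound R) n
  (poly_weight_itv R F n m) (poly_smooth_rec R F n m) t0
  (weighted_sum_le q2 (introT andP (conj m0 mn)) t0 tk tm) (leqnn n).
have G0 := geom_bound_gt0 R; set G := geom_bound R in G0 *.
have gap_le : smooth_gap R F n m <= poly_smooth_prob R F m n.
  rewrite gerBl; have u0 d : 0 <= upto R m d by case/andP: (upto_itv R m d).
  exact: (log_deriv_rec_ge0 u0 (perm_smooth_rec R n m0)).
move=> /(le_trans gap_le) /le_trans; apply.
rewrite -expRD ler_expR.
set y := expR w.
have wy : w <= y by have := expR_ge1Dx w; rewrite -/y; lra.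
have y1 : 1 <= y by have := expR_ge1Dx w; rewrite -/y /w; lra.
have y8 : y ^+ 8 = n%:R.
  rewrite /y -expRM_natr /w divfK ?pnatr_eq0 // lnK // posrE //.
have yE : (y ^+ 2) ^+ 2 <= 2 * E.
  rewrite -(@ler_pXn2r _ 2) ?nnegrE ?exprn_ge0 //; [|lra|lra].
  by rewrite -!exprM y8 exprMn; lra.
have tK : t * (m%:R * y + 2 * G) <= (1 + 2 * G) * y ^+ 2.
  have : t * m%:R * y <= y ^+ 2 by rewrite expr2 ler_wpM2r //; lra.
  have yy : y <= y ^+ 2 by rewrite expr2 ler_peMr //; lra.
  have : t * G <= G * y ^+ 2 by rewrite mulrC ler_wpM2l ?(ltW G0) //; lra.
  by lra.
(* (1 + 2 G) z <= z^2 / 64 + 16 (1 + 2 G)^2 and z^2 / 64 <= E / 32 *)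
set z := y ^+ 2 in yE tK.
have : 0 <= (z / 8 - 4 * (1 + 2 * G)) ^+ 2 by apply: sqr_ge0.
lra.
Qed.

Lemma smooth_gap_upper (R : realType) (F : finFieldType) n m : (2 <= #|F|)%N ->
  (0 < m < n)%N ->
  smooth_gap R F n m <= gap_constant R * expR (- (error_exponent R n #|F| / 16)).
Proof.
move=> q2 mn; have m0 : (0 < m)%N by case/andP: mn.
have G0 := geom_bound_gt0 R.
rewrite /gap_constant mulrDl.
have [Em|mE] := leP (error_exponent R n #|F|) (m%:R * ln #|F|%:R).
  apply: le_trans (gap_le_large R n q2 m0) _.
  rewrite ler_wpDr ?mulr_ge0 ?expR_ge0 // ler_wpM2l ?mulr_ge0 ?(ltW G0) //.
  have E0 : 0 <= error_exponent R n #|F| by rewrite le_max sqrtr_ge0.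
  by rewrite ler_expR; lra.
by rewrite ler_wpDl ?gap_le_small // !mulr_ge0 ?expR_ge0 // ltW.
Qed.

(** With s the square root in E, the choice is m = floor (s / (2 log q)).  When this
    is 0, n log n < 4 log q and m = 1 works; otherwise m is at least half of the
    unrounded value.  Finally m < n because log n <= n log q. *)
Lemma exists_good_scale (R : realType) n q : (2 <= n)%N -> (2 <= q)%N ->
  exists2 m, (0 < m < n)%N &
    3 * m%:R * ln q%:R + n%:R * ln n%:R / m%:R <= 7 * error_exponent R n q.
Proof.
move=> n2 q2; have n0 : (0 < n)%N by lia.
have lq2 := half_le_ln_nat R q2; have ln2 := half_le_ln_nat R n2.
have nq := ln_nat_le R n0 q2.
rewrite /error_exponent; set k := ln q%:R in lq2 nq *; set l := ln n%:R in ln2 nq *.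
set s := Num.sqrt _; set E := Num.max _ _.
have sE : s <= E by rewrite le_max lexx.
have kE : k <= E by rewrite le_max lexx orbT.
have s0 : 0 <= s by apply: sqrtr_ge0.
have s2 : s ^+ 2 = n%:R * l * k by rewrite sqr_sqrtr // !mulr_ge0 //; lra.
have k0 : 0 < k by lra.
have v0 : 0 <= s / (2 * k) by rewrite divr_ge0 //; lra.
have /andP[] := truncn_itv v0.
set m := Num.truncn _; rewrite ler_pdivlMr ?ltr_pdivrMr; try lra.
move=> ms sm; have [m0|m0] := posnP m.
  exists 1%N; first by [].
  rewrite divr1; move: sm; rewrite m0 mul1r => sm.
  have : n%:R * l <= 4 * k.
    by rewrite -(ler_pM2r k0) -s2; nra.
  lra.
have m1 : 1 <= m%:R :> R by rewrite ler1n.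
have snk : s <= n%:R * k.
  rewrite -(@ler_pXn2r _ 2) ?nnegrE ?mulr_ge0 //; [|lra].
  by rewrite s2 mulrAC [leRHS]expr2 ler_wpM2l // mulr_ge0 //; lra.
exists m.
  rewrite m0 -(ltr_nat R).
  have : m%:R * (2 * k) <= n%:R * k by lra.
  nra.
have : n%:R * l / m%:R <= 4 * s.
  rewrite ler_pdivrMr ?ltr0n // -(ler_pM2r k0) -s2.
  move: sm; rewrite -natr1 => sm.
  have sm' : s <= 4 * (m%:R * k) by nra.
  by nra.
nra.
Qed.

Theorem theorem1p6 (R : realType) :
  exists c C : R, [/\ 0 < c, 0 < C &
    forall (q n : nat) (F : finFieldType),
      prime_power q -> #|F| = q -> (2 <= n)%N ->
      c * expR (- (C * error_exponent R n q))
        <= E_longest_cycle R n - E_max_irr_degree R F n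
      /\ E_longest_cycle R n - E_max_irr_degree R F n
        <= C * expR (- (c * error_exponent R n q))].
Proof.
have G0 := geom_bound_gt0 R.
have K1 : 1 <= gap_constant R.
  rewrite /gap_constant -[leLHS]add0r lerD ?mulr_ge0 ?(ltW G0) //.
  by rewrite -[leLHS]expR0 ler_expR mulr_ge0 ?sqr_ge0.
(* 1/32 = 1/16 - 1/32, the second term paying for the n summands *)
exists 32^-1, (16384 * gap_constant R); split=> [||q n F _ qE n2]; [by rewrite invr_gt0|lra|].
have q2 : (2 <= #|F|)%N by apply: card_finNzRing_gt1.
have n0 : (0 < n)%N by lia.
rewrite longest_cycle_gap // -qE; set E := error_exponent R n #|F|.
have E0 : 0 <= E by rewrite /E le_max sqrtr_ge0.
split.
  have [m /andP[m0 mn] mE] := exists_good_scale R n2 q2.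
  rewrite (bigD1 (Ordinal mn)) //= ler_wpDr //.
    by apply: sumr_ge0 => j /andP[j0 _]; apply: smooth_gap_ge0.
  apply: le_trans (smooth_gap_lower R q2 (introT andP (conj m0 mn))).
  apply: (@le_trans _ _ (expR (- (7 * E)))).
    apply: (@le_trans _ _ (expR (- (16384 * gap_constant R * E)))).
      by rewrite ler_piMl ?expR_ge0 //; lra.
    by rewrite ler_expR lerN2 ler_wpM2r //; lra.
  by rewrite ler_expR lerN2.
apply: (@le_trans _ _ (\sum_(m < n) gap_constant R * expR (- (E / 16)))).
  rewrite big_mkcond /=; apply: ler_sum => m _; case: ifP => m0.
    by apply: smooth_gap_upper => //; rewrite m0 ltn_ord.
  by rewrite mulr_ge0 ?expR_ge0 //; lra.
have term0 : 0 <= gap_constant R * expR (- (E / 16)) by rewrite mulr_ge0 ?expR_ge0 //; lra.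
rewrite sumr_const card_ord -[leLHS]mulr_natl.
apply: le_trans (ler_wpM2r term0 (natr_le_expR_exponent R n2 q2)) _.
rewrite -/E le_eqVlt; apply/orP; left; apply/eqP.
have -> : - (32^-1 * E) = E / 32 - E / 16 by lra.
by rewrite expRD; ring.
Qed.
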